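(* Let $\mathcal{L}_1$ and $\mathcal{L}_2$ be propositional languages over a set $X$, let $\mathbb{A}$ be an ordered $\mathcal{L}_1$-algebra and $\mathbb{B}$ an ordered $\mathcal{L}_2$-algebra, and let $e\colon \mathbb{A}\hookrightarrow\mathbb{B}$ be an order-embedding. Let $\tau\colon\mathcal{L}_1\to\mathcal{L}_2$ and $r\colon\mathbb{B}^X\to\mathbb{A}^X$ be maps such that the following conditions hold for every $\varphi\in\mathcal{L}_1$: (a) $e([\![\varphi]\!]_V)=(\![\tau(\varphi)]\!)_{\overline{e}(V)}$ for every $V\in\mathbb{A}^X$; (b) $(\![\tau(\varphi)]\!)_U=e([\![\varphi]\!]_{r(U)})$ for every $U\in\mathbb{B}^X$. Then, for all $\varphi,\psi\in\mathcal{L}_1$, $$\mathbb{A}\models\varphi\leq\psi\quad\text{iff}\quad\mathbb{B}\models\tau(\varphi)\leq\tau(\psi).$$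
   Context: An ordered $\mathcal{L}_i$-algebra is an algebra interpreting the connectives of $\mathcal{L}_i$ whose carrier is equipped with a partial order $\leq$ (no further assumption relating operations and order is made). We identify $\mathcal{L}_i$ with its set of formulas with variables from $X$. An order-embedding $e$ is a map with $a\leq a'$ iff $e(a)\leq e(a')$. For $V\in\mathbb{A}^X$ (a valuation $X\to\mathbb{A}$) and $U\in\mathbb{B}^X$, $[\![\cdot]\!]_V\colon\mathcal{L}_1\to\mathbb{A}$ and $(\![\cdot]\!)_U\colon\mathcal{L}_2\to\mathbb{B}$ denote their unique homomorphic extensions to formulas. The map $\overline{e}\colon\mathbb{A}^X\to\mathbb{B}^X$ is $V\mapsto e\circ V$. $\mathbb{A}\models\varphi\leq\psi$ means $[\![\varphi]\!]_V\leq[\![\psi]\!]_V$ for all $V\in\mathbb{A}^X$, and $\mathbb{B}\models\alpha\leq\beta$ means $(\![\alpha]\!)_U\leq(\![\beta]\!)_U$ for all $U\in\mathbb{B}^X$. *)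

(* Defs.v *)
From Stdlib Require Vector.
From Stdlib Require Import Relation_Definitions.

Set Implicit Arguments.
Unset Strict Implicit.

(* A propositional language is given by its connectives, of arbitrary finite
   arities; its formulas over a set X of variables are the type [formula L X]. *)
Record language : Type := Language {
  connective : Type;
  arity : connective -> nat
}.

Inductive formula (L : language) (X : Type) : Type :=
| Var : X -> formula L X
| App : forall c : connective L, Vector.t (formula L X) (arity c) -> formula L X.

Arguments Var {L X} x.
Arguments App {L X} c args.

(* The order need not be decidable, and no compatibility between the operations
   and the order is required. *)
Record ordered_algebra (L : language) : Type := OrderedAlgebra {
  carrier :> Type;
  interp : forall c : connective L, Vector.t carrier (arity c) -> carrier;
  le : relation carrier;
  le_order : order carrier le
}.

Arguments interp {L} A c args : rename.
Arguments le {L} A a b : rename.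
Arguments le_order {L} A : rename.

Fixpoint eval (L : language) (X : Type) (A : ordered_algebra L) (V : X -> A)
    (phi : formula L X) {struct phi} : A :=
  match phi with
  | Var x => V x
  | App c args => interp A c (Vector.map (eval V) args)
  end.

Definition is_homomorphic_extension (L : language) (X : Type)
    (A : ordered_algebra L) (V : X -> A) (h : formula L X -> A) : Prop :=
  (forall x : X, h (Var x) = V x) /\
  (forall (c : connective L) (args : Vector.t (formula L X) (arity c)),
     h (App c args) = interp A c (Vector.map h args)).

Lemma eval_homomorphic_extension (L : language) (X : Type)
    (A : ordered_algebra L) (V : X -> A) : is_homomorphic_extension V (eval V).
Proof. split; reflexivity. Qed.

Lemma homomorphic_extension_unique (L : language) (X : Type)
    (A : ordered_algebra L) (V : X -> A) (h : formula L X -> A) :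
  is_homomorphic_extension V h -> forall phi : formula L X, h phi = eval V phi.
Proof.
intros [hV hA].
fix IH 1; intros [x | c args]; [exact (hV x) |].
rewrite hA; simpl; apply f_equal.
induction args as [| a n args IHargs]; simpl; [reflexivity |].
rewrite IH, IHargs; reflexivity.
Qed.

Definition order_embedding (L1 L2 : language) (A : ordered_algebra L1)
    (B : ordered_algebra L2) (e : A -> B) : Prop :=
  forall a a' : A, le A a a' <-> le B (e a) (e a').

Definition lift_valuation (X A B : Type) (e : A -> B) (V : X -> A) : X -> B :=
  fun x => e (V x).

(* A |= phi <= psi *)
Definition models_le (L : language) (X : Type) (A : ordered_algebra L)
    (phi psi : formula L X) : Prop :=
  forall V : X -> A, le A (eval V phi) (eval V psi).

(* Main.v *)
Require Import Defs.

(** Both directions transfer an inequality along [e], which preserves and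
    reflects the order. Going from [A] to [B], condition [hb] says that the
    values of translated formulas under [U] are the [e]-images of the values of
    the original formulas under the single valuation [r U], so an inequality
    valid in [A] is instantiated at [r U] and pushed forward. Going from [B] to
    [A], condition [ha] says that the values under [V], once embedded in [B],
    are values of translated formulas under [lift_valuation e V], so an
    inequality valid in [B] is instantiated there and reflected by [e]. *)

Theorem proposition4p1 (X : Type) (L1 L2 : language)
    (A : ordered_algebra L1) (B : ordered_algebra L2)
    (e : A -> B) (he : order_embedding e)
    (tau : formula L1 X -> formula L2 X) (r : (X -> B) -> (X -> A))
    (ha : forall (phi : formula L1 X) (V : X -> A),
       e (eval V phi) = eval (lift_valuation e V) (tau phi))
    (hb : forall (phi : formula L1 X) (U : X -> B),
       eval U (tau phi) = e (eval (r U) phi)) :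
  forall phi psi : formula L1 X,
    models_le A phi psi <-> models_le B (tau phi) (tau psi).
Proof.
  intros phi psi; split.
  - intros valid U.
    rewrite !hb.
    apply he, valid.
  - intros valid V.
    apply he.
    rewrite !ha.
    apply valid.
Qed.
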